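(* Suppose there is a function $U(n,\eta)$ and a CONGEST algorithm that, given any graph $G$ on $n$ vertices and a parameter $\eta>0$, computes an $\eta$-fair fractional orientation of $G$ in $O(U(n,\eta))$ rounds. Then there exists a CONGEST algorithm that, given $\varepsilon>0$ and a vertex $v$ as input, makes each vertex output a bit such that the subgraph $H$ induced by the vertices outputting $1$ satisfies $v\in H$ and $\rho(H)\ge(1-\varepsilon)\rho^*(v)$, after $O\big(U(n,\tfrac{\varepsilon^2}{128\log n})+\tfrac{\log^3 n}{\varepsilon^3}\big)$ rounds.
   Context: CONGEST model: synchronous rounds on the communication network $G$, each vertex sending an $O(\log n)$-bit message to each neighbour per round. A fractional orientation assigns to each edge $\overline{uv}$ nonnegative reals $\textsl{g}(u\to v),\textsl{g}(v\to u)$ summing to the edge weight; out-degree $\textsl{g}(u)=\sum_v\textsl{g}(u\to v)$. It is $\eta$-fair if $\textsl{g}(u\to v)>0$ implies $\textsl{g}(u)\le(1+\eta)\textsl{g}(v)$. For a subgraph $H$, $\rho(H)=\frac{1}{|V(H)|}\sum_{e\in E(H)}\textsl{g}(e)$. Local density: for $B\subseteq V$ and nonempty $X\subseteq V\setminus B$, let $\hat E_B(X)$ be the set of edges with one endpoint in $X$ and the other in $X\cup B$, and $\hat\rho_B(X)=\frac{1}{|X|}\sum_{e\in\hat E_B(X)}\textsl{g}(e)$. Define $B_0=\emptyset$ and, while $B_{i-1}\ne V$, let $S_i$ be a (inclusion-wise largest) maximizer of $\hat\rho_{B_{i-1}}(X)$ over nonempty $X\subseteq V\setminus B_{i-1}$,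 and $B_i=B_{i-1}\cup S_i$. For $v\in S_i$, $\rho^*(v)=\hat\rho_{B_{i-1}}(S_i)$. *)

(* Defs.v *)
(* MathComp world; the real logarithm comes from MathComp-Analysis. *)
From HB Require Import structures.
From mathcomp Require Import all_boot all_order all_algebra.
From mathcomp Require Import reals exp.

Set Implicit Arguments.
Unset Strict Implicit.
Unset Printing Implicit Defensive.

Import Order.TTheory GRing.Theory Num.Theory.
Local Open Scope ring_scope.

Record wgraph (R : realType) := WGraph {
  vertex :> finType;
  edges : {set {set vertex}};
  card_edge : forall e, e \in edges -> #|e| = 2%N;
  weight : {set vertex} -> R;  (* meaningful on [edges] only *)
  weight_ge0 : forall e, e \in edges -> 0 <= weight e
}.

Definition adj (R : realType) (G : wgraph R) (u v : G) : bool :=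
  [set u; v] \in edges G.

(* Density of the subgraph induced by X. *)
Definition density (R : realType) (G : wgraph R) (X : {set G}) : R :=
  (\sum_(e in edges G | e \subset X) weight e) / #|X|%:R.

Definition local_edges (R : realType) (G : wgraph R) (B X : {set G}) :
    {set {set G}} :=
  [set e in edges G | [exists u in X, exists v in X :|: B, e == [set u; v]]].

Definition local_density (R : realType) (G : wgraph R) (B X : {set G}) : R :=
  (\sum_(e in local_edges B X) weight e) / #|X|%:R.

Definition candidate (R : realType) (G : wgraph R) (B X : {set G}) : bool :=
  (X != set0) && (X \subset ~: B).

Definition maximizer (R : realType) (G : wgraph R) (B X : {set G}) : bool :=
  candidate B X &&
  [forall Y, candidate B Y ==> (local_density B Y <= local_density B X)].

(* An inclusion-maximal maximizer; [set0] when there is none, i.e. when B is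
   the whole vertex set. *)
Definition layer (R : realType) (G : wgraph R) (B : {set G}) : {set G} :=
  odflt set0 [pick S | maxset (maximizer B) S].

Definition prefix_set (R : realType) (G : wgraph R) (i : nat) : {set G} :=
  iter i (fun B => B :|: layer B) set0.

(* Indices are shifted by one: the layer added to [prefix_set G i] has
   number i, starting from i = 0.  Layers are nonempty until the vertex set is
   exhausted, so every vertex has a layer number below #|G|. *)
Definition layer_index (R : realType) (G : wgraph R) (v : G) : nat :=
  find (fun i => v \in layer (prefix_set G i)) (iota 0 #|G|).

Definition rho_star (R : realType) (G : wgraph R) (v : G) : R :=
  let B := prefix_set G (layer_index v) in local_density B (layer B).

(* An orientation is a function g with g u v the share g(u -> v); its values
   on non-adjacent pairs are irrelevant. *)
Definition fractional_orientation (R : realType) (G : wgraph R)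
    (g : G -> G -> R) : Prop :=
  forall u v : G, adj u v -> 0 <= g u v /\ g u v + g v u = weight [set u; v].

Definition out_degree (R : realType) (G : wgraph R) (g : G -> G -> R)
    (u : G) : R :=
  \sum_(v | adj u v) g u v.

Definition fair (R : realType) (G : wgraph R) (eta : R)
    (g : G -> G -> R) : Prop :=
  forall u v : G, adj u v -> 0 < g u v ->
    out_degree g u <= (1 + eta) * out_degree g v.

Record network (R : realType) := Network {
  net_graph :> wgraph R;
  ident : net_graph -> nat;
  ident_inj : injective ident
}.

(* Identifiers have O(log n) bits (they are below n ^ c), and the edge weights
   of an n-vertex network are drawn from W n: for instance W n = {1} for
   unweighted graphs, or W n = {1, ..., n ^ d} for weights of O(log n) bits. *)
Definition admissible (R : realType) (c : nat) (W : nat -> R -> Prop)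
    (N : network R) : Prop :=
  (forall v : N, (ident v < #|N| ^ c)%N) /\
  (forall e, e \in edges N -> W #|N| (weight e)).

(* Deterministic CONGEST algorithms with global parameter in P (known to all
   vertices), local input in I and local output in O.  Local computation is
   unrestricted.  Vertices know n and refer to their neighbours by identifier:
   - [init p n i w x] is the initial state of the vertex with identifier i and
     input x; w maps the identifiers of its neighbours to the weights of the
     corresponding edges, and other numbers to [None];
   - [send n s j] is the message sent to the neighbour with identifier j;
   - [step n s m] is the state after receiving m, where m maps the identifiers
     of the neighbours to the messages they sent, and other numbers to [None];
   - outputs are read off the states after [rounds n p] rounds. *)
Record congest (R : realType) (P I O : Type) := Congest {
  state : Type;
  init : P -> nat -> nat -> (nat -> option R) -> I -> state;
  send : nat -> state -> nat -> seq bool;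
  step : nat -> state -> (nat -> option (seq bool)) -> state;
  output : state -> O;
  rounds : nat -> P -> nat;
  bandwidth : nat;
  size_send : forall n s j, (size (send n s j) <= bandwidth * up_log 2 n)%N
}.

Definition neighbour (R : realType) (N : network R) (v : N) (j : nat) :
    option N :=
  [pick u | adj v u && (ident u == j)].

Fixpoint exec (R : realType) (P I O : Type) (A : congest R P I O)
    (N : network R) (p : P) (x : N -> I) (t : nat) (v : N) : state A :=
  if t is t'.+1 then
    let conf := exec A p x t' in
    step #|N| (conf v)
      (fun j => omap (fun u => send #|N| (conf u) (ident v)) (neighbour v j))
  else
    init A p #|N| (ident v)
      (fun j => omap (fun u => weight [set v; u]) (neighbour v j)) (x v).

Definition result (R : realType) (P I O : Type) (A : congest R P I O)
    (N : network R) (p : P) (x : N -> I) (v : N) : O :=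
  output (exec A p x (rounds A #|N| p) v).

(* The bound is uniform in both arguments; n = 1 is left out because log 1 = 0
   occurs in a denominator in the bounds of interest. *)
Definition round_bigO (R : realType) (T : nat -> R -> nat)
    (F : nat -> R -> R) : Prop :=
  exists2 C : R, 0 < C &
    forall (n : nat) (x : R), (1 < n)%N -> 0 < x -> (T n x)%:R <= C * F n x.

Definition log2 (R : realType) (n : nat) : R := ln n%:R / ln 2.

(* Main.v *)
(* Let g be an eta-fair orientation with eta = eps^2 / (128 log n), and let k be
   such that (1 + eps/4)^k > n while eta k <= eps/8.

   - The out-degree of v is almost rho*(v) or more.  Let P be the first prefix set
     containing v.  By supermodularity of the weight of induced edges, the edges
     inside P that meet a set Y contained in P weigh at least rho*(v) |Y|.  By
     fairness, those meeting Y_j = {u in P | g(u) <= (1 + eta)^j g(v)} are charged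
     to Y_(j+1) only, so if g(v) were too small, |Y_j| would grow by a factor
     1 + eps/4 at each of k steps and exceed n.

   - Let T_j be the vertices within j steps of v along arcs with g(u -> w) > 0.
     By fairness g(u) >= g(v) / (1 + eta)^j on T_j, and all the out-degree of T_j
     is carried by edges inside T_(j+1).  Hence T_(j+1) is dense enough as soon as
     |T_(j+1)| <= (1 + eps/4) |T_j|, which happens for some j < k.

   - To find j, v grows a breadth-first tree of depth k, and the sizes |T_0|, ...,
     |T_k| reach it in k rounds of pipelined convergecast. *)

Require Import Defs.
From HB Require Import structures.
From mathcomp Require Import all_boot all_order all_algebra.
From mathcomp Require Import ring lra zify.
From mathcomp Require Import boolp reals exp.
Import Order.TTheory GRing.Theory Num.Theory.
Local Open Scope ring_scope.

Set Implicit Arguments.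
Unset Strict Implicit.
Unset Printing Implicit Defensive.

(** * Local density *)

Section LocalDensity.
Variables (R : realType) (G : wgraph R).
Implicit Types (B P S T X Y Z : {set G}) (e : {set G}).

Definition inner_weight T : R := \sum_(e in edges G | e \subset T) weight e.

Lemma inner_weight_ge0 T : 0 <= inner_weight T.
Proof. by apply: sumr_ge0 => e /andP[eE _]; apply: weight_ge0. Qed.

(** Edge by edge: an edge inside both sets counts twice on each side, and an edge inside just one of
    them still lies inside the union. *)
Lemma inner_weight_supermodular X Y :
  inner_weight X + inner_weight Y <= inner_weight (X :|: Y) + inner_weight (X :&: Y).
Proof.
rewrite /inner_weight !big_mkcondr -!big_split /=.
apply: ler_sum => e eE; rewrite subsetI.
have w0 := weight_ge0 eE.
have [eX|_] := boolP (e \subset X); have [eY|_] := boolP (e \subset Y).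
- by rewrite (subset_trans eX (subsetUl _ _)).
- by rewrite (subset_trans eX (subsetUl _ _)).
- by rewrite (subset_trans eY (subsetUr _ _)) /= addr0 add0r.
- by rewrite /= !addr0; case: ifP.
Qed.

(** An edge inside [B :|: X] but not inside [B] has an endpoint outside [B], hence in [X]. Local
    weights thus become increments of [inner_weight]. *)
Lemma local_edgesE B X : X \subset ~: B ->
  local_edges B X = [set e in edges G | (e \subset B :|: X) && ~~ (e \subset B)].
Proof.
move=> XB; apply/setP => e; rewrite !inE.
case eE: (e \in edges G) => //=; apply/idP/idP.
  case/existsP => u /andP[uX] /existsP[w /andP[wXB /eqP ->]].
  apply/andP; split.
    by rewrite subUset !sub1set setUC wXB inE uX.
  apply/negP => /subsetP/(_ u); rewrite set21 => /(_ isT) uB.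
  by move/subsetP/(_ _ uX): XB; rewrite inE uB.
case/andP=> eBX.
have /cards2P[x [y [_ exy]]] : #|e| == 2%N by rewrite card_edge.
move: eBX; rewrite exy !subUset !sub1set => /andP[xBX yBX].
rewrite negb_and => /orP[xB|yB].
  apply/existsP; exists x; move: xBX; rewrite inE (negbTE xB) /= => -> /=.
  by apply/existsP; exists y; rewrite setUC yBX eqxx.
apply/existsP; exists y; move: yBX; rewrite inE (negbTE yB) /= => -> /=.
by apply/existsP; exists x; rewrite setUC xBX setUC eqxx.
Qed.

Lemma local_weightE B X : X \subset ~: B ->
  \sum_(e in local_edges B X) weight e = inner_weight (B :|: X) - inner_weight B.
Proof.
move=> XB; rewrite local_edgesE //.
apply/eqP; rewrite eq_sym subr_eq; apply/eqP.
rewrite [LHS](bigID (fun e : {set G} => e \subset B)) /= addrC.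
congr (_ + _); apply: eq_bigl => e; rewrite ?inE ?andbA //.
case: (e \in edges G) => //=.
by case: (boolP (e \subset B)) => [eB|]; rewrite ?andbF // (subset_trans eB (subsetUl _ _)).
Qed.

Lemma local_density_ge0 B X : 0 <= local_density B X.
Proof.
rewrite divr_ge0 // sumr_ge0 // => e; rewrite inE => /andP[eE _].
exact: weight_ge0.
Qed.

Lemma local_densityK B X : X \subset ~: B ->
  local_density B X * #|X|%:R = inner_weight (B :|: X) - inner_weight B.
Proof.
move=> XB; rewrite /local_density local_weightE //.
have [->|X0] := eqVneq X set0; first by rewrite cards0 mulr0 setU0 subrr.
by rewrite divfK // pnatr_eq0 cards_eq0.
Qed.

Lemma layer_maximizer B : B != setT -> maximizer B (layer B).
Proof.
move=> BT; have [y yB] : exists y, y \in ~: B.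
  by apply/set0Pn; apply: contraNneq BT => h; rewrite -[B]setCK h setC0.
have c1 : candidate B [set y].
  rewrite /candidate sub1set yB andbT.
  by apply/set0Pn; exists y; rewrite set11.
have ex : exists S, maximizer B S.
  case: (Order.TotalTheory.arg_maxP (local_density B) c1) => S cS maxS.
  exists S; rewrite /maximizer cS; apply/forallP => Y; apply/implyP => cY.
  exact: maxS.
rewrite /layer; case: pickP => [S /maxsetp //|no].
by have [S mS] := ex_maxset ex; rewrite no in mS.
Qed.

Definition layer_density B : R := local_density B (layer B).

Lemma layer_disjoint B : B != setT -> layer B \subset ~: B.
Proof. by move/layer_maximizer => /andP[/andP[]]. Qed.

Lemma layer_gain B : B != setT ->
  layer_density B * #|layer B|%:R = inner_weight (B :|: layer B) - inner_weight B.
Proof. by move=> BT; rewrite local_densityK ?layer_disjoint. Qed.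

Lemma layer_gain_max B X : B != setT -> X \subset ~: B ->
  inner_weight (B :|: X) - inner_weight B <= layer_density B * #|X|%:R.
Proof.
move=> BT XB; rewrite -local_densityK //.
have [->|X0] := eqVneq X set0; first by rewrite cards0 !mulr0.
rewrite ler_wpM2r //.
have /andP[_ /forallP/(_ X)] := layer_maximizer BT.
by rewrite /candidate X0 XB.
Qed.

(** [Z] is what remains of [P] when a set [Y] is removed, so the difference on the right weighs the
    edges inside [P] that meet [Y]. In terms of [Z], supermodularity applies directly. *)
Definition dense_towards_subsets P (r : R) :=
  forall Z, Z \subset P -> r * #|P :\: Z|%:R <= inner_weight P - inner_weight Z.

(** The removed vertices split into those in [B] and those in the new layer [S]. The hypothesis for
    [B :&: Z] and supermodularity handle the former. For the latter, all of [S] gains exactly its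
    density per vertex and [S :&: Z] at most that, so the rest gains at least that. *)
Lemma dense_add_layer B : B != setT ->
  dense_towards_subsets B (layer_density B) ->
  dense_towards_subsets (B :|: layer B) (layer_density B).
Proof.
move=> BT dB Z ZP.
have dis := layer_disjoint BT; set S := layer B in dis ZP *.
have -> : #|(B :|: S) :\: Z|%:R = #|B :\: (B :&: Z)|%:R + #|S :\: Z|%:R :> R.
  rewrite -natrD -cardsUI; congr (_%:R).
  have -> : (B :\: (B :&: Z)) :&: (S :\: Z) = set0.
    apply/setP => x; rewrite !inE.
    move/subsetP/(_ x): dis; rewrite !inE.
    by case: (x \in B); case: (x \in S); case: (x \in Z) => //= /(_ isT).
  rewrite cards0 addn0; congr #|pred_of_set _|; apply/setP => x; rewrite !inE.
  by case: (x \in B); case: (x \in S); case: (x \in Z).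
have h1 := dB (B :&: Z) (subsetIl _ _).
have h2 := inner_weight_supermodular B Z.
have h3 : inner_weight (B :|: Z) - inner_weight B
    <= layer_density B * #|S :&: Z|%:R.
  have -> : B :|: Z = B :|: (S :&: Z).
    apply/setP => x; rewrite !inE; move/subsetP/(_ x): ZP; rewrite !inE.
    by case: (x \in B); case: (x \in S); case: (x \in Z) => //= /(_ isT).
  by apply: layer_gain_max; rewrite ?(subset_trans (subsetIl _ _)).
have h4 := layer_gain BT.
have h5 : #|S|%:R = #|S :&: Z|%:R + #|S :\: Z|%:R :> R by rewrite -natrD cardsID.
rewrite -/S h5 in h4; rewrite !mulrDr in h4 *; lra.
Qed.

(** Otherwise the two consecutive layers together would be a candidate for [B] denser than
    [layer B]. *)
Lemma layer_density_nonincreasing B : B != setT -> B :|: layer B != setT ->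
  layer_density (B :|: layer B) <= layer_density B.
Proof.
have aux (a b p q x y : R) : a = p - b -> y = q - p -> q - b <= a + x -> y <= x by lra.
move=> BT PT; have dis := layer_disjoint BT.
have g1 := layer_gain BT; have g2 := layer_gain PT.
have dis2 := layer_disjoint PT.
have /andP[/andP[S0 _] _] := layer_maximizer PT.
set P := B :|: layer B in PT g1 g2 dis2 S0 *.
have c : #|layer B :|: layer P|%:R = #|layer B|%:R + #|layer P|%:R :> R.
  rewrite -natrD -cardsUI; have -> : layer B :&: layer P = set0; last by rewrite cards0 addn0.
  apply/eqP; rewrite setI_eq0 disjoint_sym disjoints_subset.
  by rewrite (subset_trans dis2) // setCS subsetUr.
have : inner_weight (B :|: (layer B :|: layer P)) - inner_weight B
   <= layer_density B * #|layer B :|: layer P|%:R.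
  apply: (layer_gain_max BT); rewrite subUset; apply/andP; split; first exact: dis.
  by apply: subset_trans dis2 _; rewrite setCS subsetUl.
rewrite setUA -/P c mulrDr => g3.
have := aux _ _ _ _ _ _ g1 g2 g3.
by rewrite ler_pM2r // ltr0n card_gt0.
Qed.

Lemma prefix_setS i :
  prefix_set G i.+1 = prefix_set G i :|: layer (prefix_set G i).
Proof. by []. Qed.

(** The rate is that of the next layer, as [dense_add_layer] needs; the induction step yields the
    rate of the layer just added, which is at least as large. *)
Lemma prefix_dense i : prefix_set G i != setT ->
  dense_towards_subsets (prefix_set G i) (layer_density (prefix_set G i)).
Proof.
elim: i => [_|i IH].
  by move=> Z; rewrite /= subset0 => /eqP ->; rewrite setD0 cards0 mulr0 subrr.
rewrite prefix_setS; set B := prefix_set G i in IH *.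
move=> PT; have BT : B != setT.
  by apply: contraNneq PT => ->; rewrite setTU.
have := dense_add_layer BT (IH BT) => d Z ZP.
apply: le_trans (d Z ZP).
exact: ler_wpM2r (ler0n _ _) _ _ (layer_density_nonincreasing BT PT).
Qed.

Lemma prefix_card i : prefix_set G i != setT -> (i <= #|prefix_set G i|)%N.
Proof.
elim: i => // i IH; rewrite prefix_setS.
set B := prefix_set G i in IH *.
move=> PT; have BT : B != setT by apply: contraNneq PT => ->; rewrite setTU.
rewrite cardsU; have -> : B :&: layer B = set0.
  by apply/eqP; rewrite setI_eq0 disjoint_sym disjoints_subset layer_disjoint.
rewrite cards0 subn0.
have /andP[/andP[S0 _] _] := layer_maximizer BT.
by rewrite -addn1 leq_add // ?IH // card_gt0.
Qed.

Lemma mem_prefix i (v : G) :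
  (v \in prefix_set G i) = has (fun j => v \in layer (prefix_set G j)) (iota 0 i).
Proof.
elim: i => [|i IH]; first by rewrite inE.
by rewrite prefix_setS inE -addn1 iotaD has_cat /= -IH orbF.
Qed.

Lemma rho_star_dense (v : G) : exists2 P : {set G}, v \in P &
  dense_towards_subsets P (rho_star v).
Proof.
have vn : v \in prefix_set G #|G|.
  have [->|PT] := eqVneq (prefix_set G #|G|) setT; first by rewrite inE.
  have := prefix_card PT; rewrite leqNgt -[X in (_ < X)%N]cardsT => /negP[].
  by apply: proper_card; rewrite properT.
move: (vn); rewrite mem_prefix => hasv.
set i := layer_index v; have := nth_find 0%N hasv.
rewrite nth_iota; last by rewrite -[X in (_ < X)%N](size_iota 0) -has_find.
rewrite add0n -/(layer_index v) -/i => vi.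
exists (prefix_set G i.+1).
  by rewrite prefix_setS inE vi orbT.
(* If the prefix before the layer of [v] were everything, [v] would lie in an earlier layer, against
   the minimality of [find]. *)
have BT : prefix_set G i != setT.
  apply/eqP => BT; have := mem_prefix i v; rewrite BT inE => /esym/(has_nthP 0%N).
  case=> j; rewrite size_iota => ji; rewrite nth_iota // add0n => vj.
  have := before_find 0%N ji; rewrite nth_iota ?add0n ?vj //.
  apply: leq_trans ji _; rewrite /i /layer_index.
  by rewrite -[X in (_ <= X)%N](size_iota 0) find_size.
by rewrite /rho_star /= -/i; apply: dense_add_layer => //; apply: prefix_dense.
Qed.

Lemma rho_star_ge0 (v : G) : 0 <= rho_star v.
Proof. exact: local_density_ge0. Qed.

End LocalDensity.

(** * Fair orientations *)

Fixpoint ball (T : finType) (r : rel T) (v : T) (t : nat) : {set T} :=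
  if t is t'.+1 then
    ball r v t' :|: [set w | [exists u in ball r v t', r u w]]
  else [set v].

Lemma ball_subset (T : finType) (r : rel T) (v : T) t : ball r v t \subset ball r v t.+1.
Proof. exact: subsetUl. Qed.

Lemma ball_mono (T : finType) (r : rel T) (v : T) m n :
  (m <= n)%N -> ball r v m \subset ball r v n.
Proof.
elim: n => [|n IH]; first by rewrite leqn0 => /eqP ->.
rewrite leq_eqVlt => /orP[/eqP -> //|/IH h].
exact: subset_trans h (ball_subset _ _ _).
Qed.

Lemma mem_ball (T : finType) (r : rel T) (v : T) t : v \in ball r v t.
Proof. by elim: t => [|t IH] /=; rewrite inE ?eqxx ?IH. Qed.

Lemma ball_step (T : finType) (r : rel T) (v u w : T) t :
  u \in ball r v t -> r u w -> w \in ball r v t.+1.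
Proof.
move=> ut uw; rewrite /= !inE; apply/orP; right.
by apply/existsP; exists u; rewrite ut.
Qed.

Lemma bernoulli_le (R : realType) (x : R) k : -1 <= x -> 1 + k%:R * x <= (1 + x) ^+ k.
Proof.
move=> x1; elim: k => [|k IH]; first by rewrite mul0r addr0 expr0.
rewrite exprS -[k.+1]addn1 natrD.
have h : 0 <= (1 + x) * ((1 + x) ^+ k - (1 + k%:R * x)).
  by apply: mulr_ge0; [lra|rewrite subr_ge0].
have h2 : 0 <= k%:R * x ^+ 2 by rewrite mulr_ge0 ?sqr_ge0.
move: h h2; move: ((1 + x) ^+ k) (k%:R : R) => a b h h2; lra.
Qed.

(** Applied twice by contraposition: sizes at most n cannot grow by a factor 1 + eps/4 at each of k
    steps. *)
Lemma geometric_growth (R : realType) (q : R) (f : nat -> nat) k : 0 <= q ->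
  (0 < f 0)%N -> (forall i, (i < k)%N -> q * (f i)%:R <= (f i.+1)%:R) ->
  q ^+ k <= (f k)%:R.
Proof.
move=> q0 f0; elim: k => [_|k IH h]; first by rewrite expr0 ler1n.
apply: le_trans (h k (ltnSn k)); rewrite exprS ler_wpM2l // IH // => i ik.
by apply: h; rewrite ltnS ltnW.
Qed.

Section Orientation.
Variables (R : realType) (G : wgraph R) (g : G -> G -> R).
Hypothesis fractional_g : fractional_orientation g.
Implicit Types (P T X Y Z : {set G}) (e : {set G}).

Lemma adj_sym (u w : G) : adj u w = adj w u.
Proof. by rewrite /adj setUC. Qed.

Lemma adj_irrefl (u : G) : adj u u = false.
Proof. by apply/negP => /card_edge; rewrite setUid cards1. Qed.

Lemma share_ge0 (u w : G) : adj u w -> 0 <= g u w.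
Proof. by case/fractional_g. Qed.

Lemma out_degree_ge0 (u : G) : 0 <= out_degree g u.
Proof. by apply: sumr_ge0 => w; apply: share_ge0. Qed.

(** Each edge inside [T] accounts for exactly two ordered pairs, whose shares add up to its
    weight. *)
Lemma inner_weight_shares T :
  inner_weight T = \sum_(u in T) \sum_(w in T | adj u w) g u w.
Proof.
rewrite pair_big_dep /=.
rewrite (partition_big (fun p : G * G => [set p.1; p.2])
  (fun e => (e \in edges G) && (e \subset T))) /=; last first.
  by case=> x y /= /and3P[xT yT xy]; rewrite subUset !sub1set xT yT !andbT.
apply: eq_bigr => e /andP[eE eT].
have /cards2P[x [y [xy exy]]] : #|e| == 2%N by rewrite card_edge.
move: eE eT; rewrite {}exy => eE; rewrite subUset !sub1set => /andP[xT yT].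
have [_ <-] := fractional_g eE.
have eE' : adj y x by rewrite adj_sym.
have nyx : (y, x) != (x, y) by rewrite xpair_eqE eq_sym (negbTE xy).
rewrite (bigD1 (x, y)) /=; last by rewrite /adj xT yT eE eqxx.
rewrite (bigD1 (y, x)) /=; last by rewrite xT yT eE' nyx [[set y; x]]setUC eqxx.
rewrite big1 ?addr0 // => -[a b] /= /andP[/andP[/andP[/and3P[_ _ ab] /eqP E] n1] n2].
have ax : a \in [set x; y] by rewrite -E set21.
have bx : b \in [set x; y] by rewrite -E set22.
have nab : a != b by apply: contraTneq ab => ->; rewrite adj_irrefl.
move: ax bx n1 n2 nab; rewrite !inE !xpair_eqE.
by case/orP=> /eqP ->; case/orP=> /eqP ->; rewrite !eqxx.
Qed.

(** Arcs from [X] that leave [Y] contribute at most 0, and the other ones appear among the shares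
    inside [Y]. *)
Lemma sum_out_degree_le X Y : X \subset Y ->
  (forall u w, u \in X -> adj u w -> 0 < g u w -> w \in Y) ->
  \sum_(u in X) out_degree g u <= inner_weight Y.
Proof.
move=> XY closed; rewrite inner_weight_shares.
rewrite [leRHS](big_setID X) /= (setIidPr XY).
rewrite -[leLHS]addr0; apply: lerD; last first.
  by apply: sumr_ge0 => u _; apply: sumr_ge0 => w /andP[_]; apply: share_ge0.
apply: ler_sum => u uX; rewrite [leRHS]big_mkcondl.
apply: ler_sum => w uw; case: ifPn => // wY.
by rewrite leNgt; apply: contra wY; apply: closed.
Qed.

(** Compare shares by tail [u]. A tail in [Y'] loses at most its out-degree; a tail in [P] outside
    [Y'] is not removed and has no positive share towards [Y], so it loses nothing. *)
Lemma removed_weight_le P Y Y' : Y \subset Y' ->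
  (forall u w, u \in P -> w \in Y -> adj u w -> 0 < g u w -> u \in Y') ->
  inner_weight P - inner_weight (P :\: Y) <= \sum_(u in Y') out_degree g u.
Proof.
move=> YY' closed; rewrite lerBlDr !inner_weight_shares.
rewrite ![\sum_(u in _) _]big_mkcond -big_split /=.
apply: ler_sum => u _; rewrite inE.
have out0 : 0 <= \sum_(w in P :\: Y | adj u w) g u w.
  by apply: sumr_ge0 => w /andP[_]; apply: share_ge0.
case: (boolP (u \in P)) => uP; last first.
  by rewrite andbF addr0; case: ifP => // _; apply: out_degree_ge0.
rewrite andbT; case: (boolP (u \in Y')) => [uY'|uY'].
  rewrite -[leLHS]addr0; apply: lerD; last by case: ifP.
  rewrite big_mkcondl; apply: ler_sum => w uw; case: ifP => // _.
  exact: share_ge0.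
have -> : u \notin Y by apply: contra uY'; apply/subsetP.
rewrite add0r ![\sum_(_ | _ && _) _]big_mkcondl; apply: ler_sum => w uw.
rewrite !inE; case: (boolP (w \in Y)) => //= wY; case: ifP => // wP.
by rewrite leNgt; apply: contra uY'; apply: closed.
Qed.

Variable eta : R.
Hypotheses (eta0 : 0 <= eta) (fair_g : fair eta g).

Lemma le1_1Deta : 1 <= 1 + eta.
Proof. by rewrite lerDl. Qed.

Lemma expr_1Deta_ge0 i : 0 <= (1 + eta) ^+ i.
Proof. by rewrite exprn_ge0 // (le_trans ler01 le1_1Deta). Qed.

Lemma rho_star_le_out_degree (v : G) (delta : R) k :
  0 <= delta -> #|G|%:R < (1 + delta) ^+ k ->
  rho_star v <= (1 + delta) * (1 + eta) ^+ k * out_degree g v.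
Proof.
(* Contrapositive: if g(v) is too small, then (1 + delta)^k <= |Y_k| <= |G|. *)
move=> d0; apply: contraTT; rewrite -ltNge -leNgt => small.
have [P vP dense] := rho_star_dense v.
have dv := out_degree_ge0 v.
have e1 := le1_1Deta; have e0 : 0 <= 1 + eta by apply: le_trans e1.
have mono i : (i <= k)%N -> (1 + eta) ^+ i <= (1 + eta) ^+ k.
  by move=> ik; apply: ler_weXn2l.
pose Y j := [set u in P | out_degree g u <= (1 + eta) ^+ j * out_degree g v].
have YS j : Y j \subset Y j.+1.
  apply/subsetP => u; rewrite !inE => /andP[-> /= h]; apply: le_trans h _.
  by rewrite ler_wpM2r // ler_weXn2l.
have vY : v \in Y 0%N by rewrite inE vP expr0 mul1r lexx.
have a0 : 0 <= (1 + eta) ^+ k * out_degree g v.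
  by rewrite mulr_ge0 // exprn_ge0.
apply: le_trans (_ : #|Y k|%:R <= _); last by rewrite ler_nat max_card.
apply: (geometric_growth (f := fun j => #|Y j|)); first by apply: addr_ge0.
  by rewrite card_gt0; apply/set0Pn; exists v.
move=> j jk.
have YP : Y j \subset P by apply/subsetP => u; rewrite inE => /andP[].
have h1 : rho_star v * #|Y j|%:R <= \sum_(u in Y j.+1) out_degree g u.
  have -> : #|Y j|%:R = #|P :\: (P :\: Y j)|%:R :> R.
    by congr (_%:R); congr #|pred_of_set _|; rewrite setDDr setDv set0U (setIidPr YP).
  apply: le_trans (dense _ (subsetDl _ _)) _.
  apply: removed_weight_le => // u w uP; rewrite !inE => /andP[wP wj] uw guw.
  rewrite uP /=; apply: le_trans (fair_g uw guw) _.
  by rewrite exprS -mulrA ler_wpM2l.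
have h2 : \sum_(u in Y j.+1) out_degree g u
    <= #|Y j.+1|%:R * ((1 + eta) ^+ k * out_degree g v).
  rewrite mulr_natl -sumr_const; apply: ler_sum => u.
  rewrite inE => /andP[_ h]; apply: le_trans h _.
  by rewrite ler_wpM2r // mono.
have h3 := le_trans h1 h2; rewrite -mulrA in small.
have n1 : 0 <= #|Y j.+1|%:R :> R by [].
move: h3 small a0 n1; rewrite -/(Y j.+1).
move: (_ * out_degree g v) (rho_star v) #|Y j|%:R #|Y j.+1|%:R d0.
move=> {}a {}r x y {}d0 h3 small a0 n1.
(* [small] is strict and its left side is nonnegative, so rho*(v) is positive and can be
   cancelled. *)
have r0 : 0 < r by nra.
rewrite -(ler_pM2l r0).
have : (1 + delta) * (r * x) <= (1 + delta) * (y * a).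
  by rewrite ler_wpM2l // addr_ge0.
nra.
Qed.

Definition positive_share (u w : G) : bool := adj u w && (0 < g u w).

Lemma ball_out_degree (v u : G) i : u \in ball positive_share v i ->
  out_degree g v <= (1 + eta) ^+ i * out_degree g u.
Proof.
elim: i u => [|i IH] u /=; rewrite !inE; first by move/eqP=> ->; rewrite expr0 mul1r.
have e1 := le1_1Deta.
case/orP => [/IH h|/existsP[w /andP[/IH h /andP[wu gwu]]]]; apply: le_trans h _.
  by rewrite ler_wpM2r ?out_degree_ge0 // ler_weXn2l.
by rewrite exprSr -mulrA ler_wpM2l ?expr_1Deta_ge0 ?fair_g.
Qed.

Lemma ball_weight (v : G) i :
  out_degree g v * #|ball positive_share v i|%:R <=
    (1 + eta) ^+ i * inner_weight (ball positive_share v i.+1).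
Proof.
rewrite mulr_natr -sumr_const.
apply: le_trans (_ : (1 + eta) ^+ i *
  \sum_(u in ball positive_share v i) out_degree g u <= _).
  rewrite mulr_sumr; apply: ler_sum => u; exact: ball_out_degree.
rewrite ler_wpM2l ?expr_1Deta_ge0 //.
apply: sum_out_degree_le; first exact: ball_subset.
move=> u w uX uw guw; apply: ball_step uX _.
by rewrite /positive_share uw.
Qed.

(** The factor (1 + delta)(1 + eta)^k is lost twice: between rho*(v) and g(v), and between g(v) and
    the density of the ball, where 1 + delta pays for the growth of the ball and (1 + eta)^k for the
    drop in out-degree. *)
Lemma ball_density (v : G) (delta : R) k i :
  0 <= delta -> #|G|%:R < (1 + delta) ^+ k -> (i < k)%N ->
  #|ball positive_share v i.+1|%:R <= (1 + delta) * #|ball positive_share v i|%:R ->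
  rho_star v <= ((1 + delta) * (1 + eta) ^+ k) ^+ 2 *
    density (ball positive_share v i.+1).
Proof.
move=> d0 nk ik grow.
have h1 := rho_star_le_out_degree v d0 nk; have h2 := ball_weight v i.
have h3 : (1 + eta) ^+ i <= (1 + eta) ^+ k.
  by apply: ler_weXn2l; [exact: le1_1Deta|exact: ltnW].
have w0 := inner_weight_ge0 (ball positive_share v i.+1).
have e1 := expr_1Deta_ge0 i.
rewrite /density -/(inner_weight _) mulrA ler_pdivlMr; last first.
  by rewrite ltr0n card_gt0; apply/set0Pn; exists v; apply: mem_ball.
have r0 := rho_star_ge0 v; have dv := out_degree_ge0 v.
move: h1 h2 h3 w0 e1 r0 dv grow.
move: (rho_star v) (out_degree g v) (inner_weight _) (_ ^+ i) (_ ^+ k).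
move: #|ball _ _ i|%:R (ler0n R #|ball positive_share v i|).
move: #|ball _ _ i.+1|%:R (ler0n R #|ball positive_share v i.+1|).
move=> y y0 x x0 r a w p q h1 h2 h3 w0 p0 r0 a0 yx.
have q0 : 0 <= (1 + delta) * q by apply: mulr_ge0; lra.
have s1 : r * y <= (1 + delta) * q * a * ((1 + delta) * x).
  by apply: ler_pM.
have s2 : (1 + delta) * ((1 + delta) * q) * (a * x) <=
    (1 + delta) * ((1 + delta) * q) * (q * w).
  apply: ler_wpM2l; first by apply: mulr_ge0; lra.
  by apply: le_trans h2 _; rewrite ler_wpM2r.
have E1 : (1 + delta) * q * a * ((1 + delta) * x) =
    (1 + delta) * ((1 + delta) * q) * (a * x) by ring.
have E2 : ((1 + delta) * q) ^+ 2 * w =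
    (1 + delta) * ((1 + delta) * q) * (q * w) by ring.
by rewrite E2; apply: le_trans s2; rewrite -E1.
Qed.

End Orientation.

(** * The search radius and its numerical estimates *)

(** The first factor exceeds 4/eps, so raising 1 + eps/4 to it gives at least 2 by Bernoulli; the
    second exceeds log n. For eps >= 1 the density claim is void and the round bound tends to 0 as
    eps grows, so the radius is set to 0. *)
Definition search_radius (R : realType) (n : nat) (eps : R) : nat :=
  if eps < 1 then ((Num.truncn (4 / eps)).+1 * (trunc_log 2 n).+1)%N else 0%N.

Lemma search_radius_growth (R : realType) (n : nat) (eps : R) :
  0 < eps < 1 -> n%:R < (1 + eps / 4) ^+ search_radius n eps.
Proof.
case/andP=> e0 e1; rewrite /search_radius e1 exprM.
apply: lt_le_trans (_ : 2 ^+ (trunc_log 2 n).+1 <= _).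
  by rewrite -natrX ltr_nat trunc_log_ltn.
apply: lerXn2r; rewrite ?nnegrE ?exprn_ge0 //; first by lra.
have m4 := truncnS_gt (4 / eps); set m := (Num.truncn _).+1 in m4 *.
have b : 1 + m%:R * (eps / 4) <= (1 + eps / 4) ^+ m.
  by apply: bernoulli_le; lra.
apply: le_trans b; rewrite ltr_pdivrMr // in m4; lra.
Qed.

Lemma le1_log2 (R : realType) (n : nat) : (1 < n)%N -> 1 <= log2 R n.
Proof.
move=> n1; have l2 : 0 < ln 2 :> R by rewrite ln_gt0 // ltr1n.
rewrite /log2 ler_pdivlMr // mul1r ler_ln ?posrE ?ltr0n ?ler_nat //; lia.
Qed.

Lemma trunc_log_le_log2 (R : realType) (n : nat) : (1 < n)%N ->
  (trunc_log 2 n)%:R <= log2 R n.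
Proof.
move=> n1; have l2 : 0 < ln 2 :> R by rewrite ln_gt0 // ltr1n.
rewrite /log2 ler_pdivlMr // mulr_natl -lnXn ?ltr0n // -natrX.
rewrite ler_ln ?posrE ?ltr0n ?ler_nat ?expn_gt0 // ?trunc_logP //; lia.
Qed.

Lemma search_radius_le (R : realType) (n : nat) (eps : R) : (1 < n)%N ->
  0 < eps < 1 -> (search_radius n eps)%:R <= 10 * (log2 R n / eps).
Proof.
move=> n1 /andP[e0 e1]; rewrite /search_radius e1 natrM.
have L1 := le1_log2 R n1; have tL := trunc_log_le_log2 R n1.
have m4 : (Num.truncn (4 / eps))%:R <= 4 / eps by rewrite truncn_le divr_ge0 ?ltW.
have v1 : 1 < eps^-1 by rewrite invf_gt1.
rewrite -(natr1 (Num.truncn _)) -(natr1 (trunc_log _ _)).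
(* The added ones are absorbed because 1 < 1/eps and 1 <= log n. *)
apply: le_trans (_ : (5 * eps^-1) * (2 * log2 R n) <= _); last by lra.
by apply: ler_pM; rewrite ?addr_ge0 //; lra.
Qed.

Lemma search_radius_bigO (R : realType) (n : nat) (eps : R) : (1 < n)%N ->
  0 < eps -> (search_radius n eps)%:R <= 10 * (log2 R n ^+ 3 / eps ^+ 3).
Proof.
move=> n1 e0; have L1 := le1_log2 R n1.
case: (ltP eps 1) => e1; last first.
  rewrite /search_radius ltNge e1 /= mulr_ge0 // divr_ge0 // exprn_ge0 //; lra.
have e01 : 0 < eps < 1 by rewrite e0.
apply: le_trans (search_radius_le n1 e01) _.
rewrite ler_wpM2l // -expr_div_n.
(* For eps < 1 the ratio log n / eps is at least 1, hence at most its cube. *)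
apply: (@ler_eXnr _ _ 3) => //; rewrite ler_pdivlMr //; lra.
Qed.

Lemma fairness_power (R : realType) (n : nat) (eps : R) : (1 < n)%N ->
  0 < eps < 1 ->
  (1 - eps) *
    ((1 + eps / 4) * (1 + eps ^+ 2 / (128 * log2 R n)) ^+ search_radius n eps) ^+ 2
  <= 1.
Proof.
move=> n1 e01; have /andP[e0 e1] := e01.
have L1 := le1_log2 R n1; have kL := search_radius_le n1 e01.
have L0 : 0 < log2 R n by lra.
set eta := eps ^+ 2 / _; set k := search_radius n eps in kL *.
have eta0 : 0 < eta by rewrite divr_gt0 ?exprn_gt0 // mulr_gt0.
(* As k <= 10 log n / eps, the product is at most 10 eps / 128. *)
have ke : k%:R * eta <= eps / 8.
  apply: le_trans (ler_wpM2r (ltW eta0) kL) _.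
  have -> : 10 * (log2 R n / eps) * eta = 10 / 128 * eps.
    by rewrite /eta; field; rewrite !gt_eqF.
  lra.
have eta1 : eta < 1.
  have L128 : 0 < 128 * log2 R n by lra.
  by rewrite /eta ltr_pdivrMr // mul1r; nra.
have b : 1 - eps / 8 <= (1 - eta) ^+ k.
  by apply: le_trans (bernoulli_le k _); [lra|lra].
(* As (1 - eta^2)^k <= 1, Bernoulli's lower bound for (1 - eta)^k becomes an upper bound for (1 +
   eta)^k. *)
have inv : (1 - eta) ^+ k * (1 + eta) ^+ k <= 1.
  by rewrite -exprMn exprn_ile1 //; nra.
have q0 : 0 <= (1 + eta) ^+ k by rewrite exprn_ge0 //; lra.
have q1 : (1 - eps / 8) * (1 + eta) ^+ k <= 1.
  by apply: le_trans inv; rewrite ler_wpM2r.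
move: q0 q1; move: (_ ^+ k) => q q0 q1.
have s : (1 - eps) * (1 + eps / 4) ^+ 2 <= (1 - eps / 8) ^+ 2 by nra.
apply: le_trans (_ : ((1 - eps / 8) * q) ^+ 2 <= _); last first.
  by rewrite exprn_ile1 // mulr_ge0 //; lra.
by rewrite !exprMn mulrA ler_wpM2r // sqr_ge0.
Qed.

(** * CONGEST algorithms *)

Section Reparametrize.
Variables (R : realType) (P P' I I' O O' : Type).
Variables (f : nat -> P' -> P) (h : I' -> I) (r : O -> O') (A : congest R P I O).

(** [f] also takes n because the fairness parameter depends on log n. *)
Definition reparametrize : congest R P' I' O' :=
  @Congest R P' I' O' (state A) (fun p n i w x => init A (f n p) n i w (h x))
    (@send _ _ _ _ A) (@step _ _ _ _ A) (fun s => r (output s))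
    (fun n p => rounds A n (f n p)) (bandwidth A) (@size_send _ _ _ _ A).

Lemma result_reparametrize (N : network R) p (x : N -> I') (v : N) :
  result reparametrize p x v = r (result A (f #|N| p) (fun u => h (x u)) v).
Proof.
rewrite /result /=; congr (r (output _)).
elim: (rounds A _ _) v => [|t IH] v //=.
rewrite IH; congr step; apply: funext => j.
by case: (neighbour v j) => //= u; rewrite IH.
Qed.

End Reparametrize.

(** * Running one algorithm after another *)

Section SequentialComposition.
Variables (R : realType) (P I O1 O2 : Type).
Variables (A : congest R P I O1) (B : congest R P (I * O1) O2).

(** Kept during the first run so that the second algorithm can be initialised from it. *)
Definition local_info : Type := P * nat * nat * (nat -> option R) * I.

(* [First l t s]: the first algorithm is in state [s] with [t.+1] rounds to go. *)
Inductive seq_state : Type :=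
  | First of local_info & nat & state A
  | Second of state B.

Definition seq_resume (l : local_info) (t : nat) (s : state A) : seq_state :=
  if t is t'.+1 then First l t' s
  else let: (p, n, i, w, x) := l in Second (init B p n i w (x, output s)).

Definition seq_send (n : nat) (s : seq_state) (j : nat) : seq bool :=
  match s with
  | First _ _ s' => send n s' j
  | Second s' => send n s' j
  end.

Definition seq_step (n : nat) (s : seq_state) (m : nat -> option (seq bool)) :=
  match s with
  | First l t s' => seq_resume l t (step n s' m)
  | Second s' => Second (step n s' m)
  end.

(* The junk value is read only while the first algorithm is still running. *)
Definition seq_output (junk : O2) (s : seq_state) : O2 :=
  if s is Second s' then output s' else junk.

Lemma size_seq_send n s j :
  (size (seq_send n s j) <= maxn (bandwidth A) (bandwidth B) * up_log 2 n)%N.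
Proof.
case: s => [l t s|s]; apply: leq_trans (size_send _ _ _) _;
  by rewrite leq_mul2r ?leq_maxl ?leq_maxr orbT.
Qed.

Definition seq_compose (junk : O2) : congest R P I O2 :=
  @Congest R P I O2 seq_state
    (fun p n i w x => seq_resume (p, n, i, w, x) (rounds A n p) (init A p n i w x))
    seq_send seq_step (seq_output junk) (fun n p => rounds A n p + rounds B n p)%N
    (maxn (bandwidth A) (bandwidth B)) size_seq_send.

Variables (junk : O2) (N : network R) (p : P) (x : N -> I).
Let C := seq_compose junk.
Let info (v : N) : local_info :=
  (p, #|N|, ident v, fun j => omap (fun u => weight [set v; u]) (neighbour v j), x v).

(** [seq_resume] covers the end of the first run too: with 0 rounds left it is already the initial
    state of [B]. *)
Lemma exec_seq_first t (v : N) : (t <= rounds A #|N| p)%N ->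
  exec C p x t v = seq_resume (info v) (rounds A #|N| p - t) (exec A p x t v).
Proof.
elim: t v => [|t IH] v tA; first by rewrite subn0.
have {}IH u : exec C p x t u = First (info u) (rounds A #|N| p - t.+1) (exec A p x t u).
  by rewrite IH ?(ltnW tA) // -(subnSK tA).
rewrite [LHS]/= IH /=; congr seq_resume; congr step; apply: funext => j.
by case: (neighbour v j) => //= u; rewrite IH.
Qed.

Lemma exec_seq_second t (v : N) :
  exec C p x (rounds A #|N| p + t) v =
    Second (exec B p (fun u => (x u, result A p x u)) t v).
Proof.
elim: t v => [|t IH] v; first by rewrite addn0 exec_seq_first // subnn.
rewrite addnS [LHS]/= IH /=; congr Second; congr step; apply: funext => j.
by case: (neighbour v j) => //= u; rewrite IH.
Qed.

Lemma result_seq_compose (v : N) :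
  result C p x v = result B p (fun u => (x u, result A p x u)) v.
Proof. by rewrite /result exec_seq_second. Qed.

End SequentialComposition.

Section Neighbours.
Variables (R : realType) (N : network R).

Lemma neighbour_ident (u w : N) : adj u w -> neighbour u (ident w) = Some w.
Proof.
move=> uw; rewrite /neighbour; case: pickP => [w' /andP[_ /eqP/ident_inj ->] //|/(_ w)].
by rewrite uw eqxx.
Qed.

Lemma neighbourP (u w : N) j : neighbour u j = Some w -> adj u w /\ ident w = j.
Proof. by rewrite /neighbour; case: pickP => // w' /andP[uw /eqP wj] [<-]. Qed.

Lemma adj_card (u w : N) : adj u w -> (1 < #|N|)%N.
Proof. by move/card_edge <-; apply: max_card. Qed.

(** Messages are indexed by identifiers; by injectivity each neighbour is met once, and other
    numbers contribute 0. *)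
Lemma sum_neighbour (b : nat) (u : N) (F : N -> nat) :
  (forall w : N, ident w < b)%N ->
  (\sum_(j < b) oapp F 0 (neighbour u j) = \sum_(w | adj u w) F w)%N.
Proof.
move=> idb; rewrite [RHS](partition_big (fun w => Ordinal (idb w)) predT) //=.
apply: eq_bigr => j _; case nj: (neighbour u j) => [w|] /=.
  have [uw wj] := neighbourP nj; rewrite (big_pred1 w) // => w' /=.
  rewrite -val_eqE /= -wj (inj_eq (@ident_inj _ N)).
  by case: eqP => [->|]; rewrite ?uw ?andbF.
rewrite big_pred0 // => w; apply/negP => /andP[uw /eqP wj].
by move: nj; rewrite -wj /= neighbour_ident.
Qed.

End Neighbours.

(** * Flooding along arcs *)

Section Flood.
Variables (R : realType) (P I : Type) (c : nat) (duration : nat -> P -> nat).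
Variables (out : I -> nat -> bool) (start : nat -> P -> I -> option nat).

(** One flood serves twice: started at once, it builds the breadth-first tree through
    [flood_parent]; with a delay held in [flood_timer], it marks a ball. *)
Record flood_state := FloodState {
  flood_out : nat -> bool;
  flood_timer : option nat;
  flood_reached : bool;
  flood_parent : option nat
}.

Definition flood_init (p : P) (n _ : nat) (_ : nat -> option R) (x : I) :=
  FloodState (out x) (start n p x) (start n p x == Some 0%N) None.

(** Any nonempty message announces the flood. A length of [up_log 2 n] respects the bandwidth even
    for n = 1, and is nonzero as soon as there is a neighbour. *)
Definition flood_send (n : nat) (s : flood_state) (j : nat) : seq bool :=
  if flood_reached s && flood_out s j then nseq (up_log 2 n) true else [::].

Definition senders (n : nat) (m : nat -> option (seq bool)) : seq nat :=
  [seq j <- iota 0 (n ^ c) | odflt [::] (m j) != [::]].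

Definition flood_step (n : nat) (s : flood_state) (m : nat -> option (seq bool)) :=
  let timer := omap predn (flood_timer s) in
  FloodState (flood_out s) timer
    [|| flood_reached s, timer == Some 0%N | senders n m != [::]]
    (if flood_reached s then flood_parent s else ohead (senders n m)).

Lemma size_flood_send n s j : (size (flood_send n s j) <= 1 * up_log 2 n)%N.
Proof. by rewrite /flood_send mul1n; case: ifP; rewrite ?size_nseq. Qed.

Definition flood : congest R P I (bool * option nat) :=
  @Congest R P I (bool * option nat) flood_state flood_init flood_send flood_step
    (fun s => (flood_reached s, flood_parent s)) duration 1 size_flood_send.

Variables (N : network R) (p : P) (x : N -> I) (v : N) (d : nat).
Hypothesis ident_lt : forall u : N, (ident u < #|N| ^ c)%N.
Hypothesis start_x :
  forall u : N, start #|N| p (x u) = if u == v then Some d else None.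

Let arc (u w : N) : bool := adj u w && out (x u) (ident w).

Let inbox t (w : N) (j : nat) : option (seq bool) :=
  omap (fun u => send #|N| (exec flood p x t u) (ident w)) (neighbour w j).

Lemma flood_outE t (u : N) : flood_out (exec flood p x t u) = out (x u).
Proof. by elim: t. Qed.

Lemma flood_timerE t (u : N) :
  flood_timer (exec flood p x t u) = if u == v then Some (d - t)%N else None.
Proof.
elim: t => [|t IH] /=; first by rewrite start_x subn0.
by rewrite IH; case: ifP => //= _; rewrite subnS.
Qed.

Lemma mem_senders t (w : N) j :
  reflect (exists u : N, [/\ ident u = j, flood_reached (exec flood p x t u) & arc u w])
    (j \in senders #|N| (inbox t w)).
Proof.
rewrite mem_filter mem_iota add0n; apply: (iffP andP).
  case; rewrite /inbox; case nj: (neighbour w j) => [u|] //=.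
  have [wu uj] := neighbourP nj.
  rewrite /flood_send flood_outE; case: ifP => // /andP[ru ou] _ _.
  by exists u; rewrite /arc adj_sym wu.
case=> u [<- ru /andP[uw ou]]; split; last exact: ident_lt.
rewrite /inbox neighbour_ident 1?adj_sym //= /flood_send flood_outE ru ou /=.
by rewrite -size_eq0 size_nseq up_log_eq0 negb_or -!ltnNge (adj_card uw).
Qed.

Lemma senders_neq0 t (w : N) : (senders #|N| (inbox t w) != [::]) =
  [exists u, flood_reached (exec flood p x t u) && arc u w].
Proof.
apply/idP/existsP => [|[u /andP[ru uw]]].
  case E: (senders _ _) => [|j s] // _.
  have : j \in senders #|N| (inbox t w) by rewrite E mem_head.
  by case/mem_senders=> u [_ ru uw]; exists u; rewrite ru.
have : ident u \in senders #|N| (inbox t w) by apply/mem_senders; exists u.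
by case: (senders _ _).
Qed.

(** Nothing happens before round [d], when the source is marked; each later round adds one layer of
    the ball. The conjunct [d <= t] guards the truncated subtraction. *)
Lemma flood_reachedE t (w : N) :
  flood_reached (exec flood p x t w) = (d <= t)%N && (w \in ball arc v (t - d)).
Proof.
elim: t w => [|t IH] w.
  rewrite sub0n [LHS]/= start_x inE; case: (w =P v) => _; rewrite ?andbF //.
  by rewrite andbT leqn0.
rewrite [LHS]/= -/(inbox t w) senders_neq0 flood_timerE IH.
have -> : [exists u, flood_reached (exec flood p x t u) && arc u w] =
    (d <= t)%N && [exists u in ball arc v (t - d), arc u w].
  under eq_existsb => u do rewrite IH -andbA.
  case: (d <= t)%N => //=; apply/existsP => -[u //].
case: (ltngtP d t.+1) => [dt|dt|->].
- have dt' : (d <= t)%N by [].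
  rewrite dt' subSn //= !inE; by case: (w =P v) => [->|_]; rewrite ?mem_ball.
- have dt' : (d <= t)%N = false by rewrite leqNgt (ltnW dt).
  rewrite dt' /= orbF; case: (w =P v) => // _.
  by apply/eqP => -[]; rewrite -subnS => /eqP; rewrite subn_eq0 leqNgt dt.
- rewrite ltnn subnn inE /= orbF; case: (w =P v) => // _.
  by rewrite subSnn.
Qed.

Lemma result_flood (w : N) : (d <= duration #|N| p)%N ->
  (result flood p x w).1 = (w \in ball arc v (duration #|N| p - d)).
Proof. by move=> dr; rewrite /result /= flood_reachedE dr. Qed.

Lemma flood_parent_arc t (w : N) j : flood_parent (exec flood p x t w) = Some j ->
  exists2 u : N, arc u w & ident u = j.
Proof.
elim: t => [|t IH] //=; case: ifP => // _; rewrite -/(inbox t w).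
case E: (senders _ _) => [|j' s] //= [<-].
have : j' \in senders #|N| (inbox t w) by rewrite E mem_head.
by case/mem_senders=> u [uj _ uw]; exists u.
Qed.

Hypothesis d0 : d = 0%N.

Lemma flood_parent_source t : flood_parent (exec flood p x t v) = None.
Proof.
by elim: t => [|t IH] //=; rewrite IH flood_reachedE d0 mem_ball.
Qed.

(** A vertex at depth s + 1 is first reached in round s + 1; its parent is fixed in that round,
    among senders already reached by round s. *)
Lemma flood_parent_ball t s (w : N) : (s < t)%N ->
  w \in ball arc v s.+1 -> w \notin ball arc v s ->
  exists2 u : N, u \in ball arc v s & flood_parent (exec flood p x t w) = Some (ident u).
Proof.
move=> + ws1 ws; elim: t => // t IH; rewrite ltnS leq_eqVlt => /orP[/eqP st|st].
  rewrite /= flood_reachedE d0 subn0 -st (negbTE ws) -/(inbox s w) /=.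
  have : senders #|N| (inbox s w) != [::].
    rewrite senders_neq0; move: ws1; rewrite /= inE (negbTE ws) inE /=.
    case/existsP=> u /andP[us uw]; apply/existsP; exists u.
    by rewrite flood_reachedE d0 subn0 us.
  case E: (senders _ _) => [|j l] // _.
  have : j \in senders #|N| (inbox s w) by rewrite E mem_head.
  case/mem_senders=> u [<- + _]; rewrite flood_reachedE d0 subn0 => us.
  by exists u.
have [u us pu] := IH st; exists u => //=.
rewrite flood_reachedE d0 subn0 /=; case: ifP => // /negP[].
exact: (subsetP (ball_mono _ _ st)).
Qed.

End Flood.

(** * Binary messages and counting by convergecast *)

Fixpoint encode_bits (b m : nat) : seq bool :=
  if b is b'.+1 then odd m :: encode_bits b' m./2 else [::].

Definition decode_bits : seq bool -> nat := foldr (fun (b : bool) m => b + m.*2)%N 0%N.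

Lemma size_encode_bits b m : size (encode_bits b m) = b.
Proof. by elim: b m => //= b IH m; rewrite IH. Qed.

Lemma encode_bitsK b m : (m < 2 ^ b)%N -> decode_bits (encode_bits b m) = m.
Proof.
elim: b m => [|b IH] m /=; first by case: m.
rewrite expnS mul2n => mb; rewrite IH ?odd_double_half //.
by rewrite ltn_half_double.
Qed.

Section Convergecast.
Variables (R : realType) (P I : Type) (c : nat) (duration : nat -> P -> nat).
Variable parent : I -> option nat.

Record tally_state := TallyState {
  tally_parent : option nat;
  tally_count : nat;
  tally_history : seq nat
}.

Definition tally_init (_ : P) (_ _ : nat) (_ : nat -> option R) (x : I) :=
  TallyState (parent x) 1 [:: 1%N].

(** A count can equal n, which does not fit in [up_log 2 n] bits when n is a power of 2; twice as
    many bits suffice for n > 1. *)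
Definition tally_send (n : nat) (s : tally_state) (j : nat) : seq bool :=
  if tally_parent s == Some j then encode_bits (2 * up_log 2 n) (tally_count s)
  else [::].

Definition tally_step (n : nat) (s : tally_state) (m : nat -> option (seq bool)) :=
  let a := ((if tally_parent s is None then tally_count s else 0) +
            \sum_(j < n ^ c) decode_bits (odflt [::] (m j)))%N in
  TallyState (tally_parent s) a (rcons (tally_history s) a).

Lemma size_tally_send n s j : (size (tally_send n s j) <= 2 * up_log 2 n)%N.
Proof. by rewrite /tally_send; case: ifP; rewrite ?size_encode_bits. Qed.

(* Every vertex starts with one token, and in each round the non-roots pass all
   their tokens on to their parents; so after t rounds the root of a tree holds
   one token for each vertex of depth at most t. *)
Definition convergecast : congest R P I (seq nat) :=
  @Congest R P I (seq nat) tally_state tally_init tally_send tally_step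
    tally_history duration 2 size_tally_send.

Variables (N : network R) (p : P) (x : N -> I) (par : N -> option N).
Hypothesis ident_lt : forall u : N, (ident u < #|N| ^ c)%N.
Hypothesis parent_x : forall u, parent (x u) = omap (@ident R N) (par u).
Hypothesis par_adj : forall u w, par u = Some w -> adj u w.

Let up (u : N) : N := odflt u (par u).
Let tokens t (u : N) : nat := #|[set w | iter t up w == u]|.

(** Sort the tokens by their position [w] after t rounds. The term [w = u] survives only at a root,
    since [up] fixes roots and the graph has no loops. *)
Lemma tokensS t (u : N) : tokens t.+1 u =
  ((if par u is None then tokens t u else 0) +
   \sum_(w | adj u w) if par w == Some u then tokens t w else 0)%N.
Proof.
have -> : tokens t.+1 u = (\sum_(w | up w == u) tokens t w)%N.
  rewrite /tokens -sum1_card (partition_big (iter t up) (fun w => up w == u)) /=.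
    apply: eq_bigr => w uw; rewrite -sum1_card; apply: eq_bigl => y.
    rewrite !inE; apply/andP/eqP => [[_ /eqP] //|yw].
    by rewrite /= yw uw eqxx.
  by move=> y; rewrite inE.
rewrite (bigID (fun w => w == u)) /=; congr addn.
  have [pu|[w pu]] : par u = None \/ exists w, par u = Some w.
    by case: (par u) => [w|]; [right; exists w|left].
  - rewrite pu (big_pred1 u) // => w /=; case: (w =P u) => [->|]; rewrite ?andbF //.
    by rewrite /up pu eqxx.
  - rewrite pu big_pred0 // => y; apply/negP => /andP[/eqP + /eqP yu].
    rewrite /up yu pu /= => wu; have := par_adj pu.
    by rewrite wu adj_irrefl.
rewrite -big_mkcondr; apply: eq_bigl => w; rewrite /up.
apply/andP/andP; case E: (par w) => [y|] /=.
- case=> /eqP yu wu; move: (par_adj E); rewrite yu => wu'.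
  by rewrite adj_sym wu' eqxx.
- by case=> ->.
- case=> uw /eqP[yu]; rewrite yu eqxx; split=> //.
  by apply: contraTneq uw => ->; rewrite adj_irrefl.
- by case.
Qed.

Lemma convergecast_exec t (u : N) : exec convergecast p x t u =
  TallyState (parent (x u)) (tokens t u) [seq tokens s u | s <- iota 0 t.+1].
Proof.
elim: t u => [|t IH] u.
  have -> : tokens 0 u = 1%N by rewrite -(cards1 u); apply: eq_card => w; rewrite !inE.
  rewrite /= /tally_init; congr (TallyState _ _ [:: _]).
  by rewrite -(cards1 u); apply: eq_card => w; rewrite !inE.
have -> : [seq tokens s u | s <- iota 0 t.+2] =
    rcons [seq tokens s u | s <- iota 0 t.+1] (tokens t.+1 u).
  by rewrite -[t.+2]addn1 iotaD map_cat cats1.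
rewrite [LHS]/= /tally_step IH /=.
have -> : (\sum_(j < #|N| ^ c) decode_bits (odflt [::]
    (omap (fun w => tally_send #|N| (exec convergecast p x t w) (ident u))
       (neighbour u j))) =
    \sum_(w | adj u w) if par w == Some u then tokens t w else 0)%N.
  rewrite -(sum_neighbour u _ ident_lt); apply: eq_bigr => j _.
  case nj: (neighbour u j) => [w|] //=.
  have [uw _] := neighbourP nj; rewrite IH /tally_send /= parent_x.
  have -> : (omap (@ident R N) (par w) == Some (ident u)) = (par w == Some u).
    case: (par w) => //= y; rewrite !(inj_eq Some_inj); exact: inj_eq (@ident_inj _ N) _ _.
  case: ifP => // _; rewrite encode_bitsK //.
  have n1 := adj_card uw.
  apply: leq_ltn_trans (max_card _) _; rewrite mulnC expnM.
  apply: leq_ltn_trans (up_logP #|N| (ltnSn 1)) _.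
  rewrite -[X in (X < _)%N]expn1 ltn_exp2l // -(expn0 2) ltn_exp2l //.
  by rewrite up_log_gt0.
rewrite parent_x; have -> : (if omap (@ident R N) (par u) is None then tokens t u else 0%N) =
   (if par u is None then tokens t u else 0%N) by case: (par u).
by rewrite -tokensS.
Qed.

Lemma result_convergecast (u : N) : result convergecast p x u =
  [seq tokens s u | s <- iota 0 (duration #|N| p).+1].
Proof. by rewrite /result convergecast_exec. Qed.

End Convergecast.

(** A parent pointer reverses an arc, so climbing to [v] in s steps gives a path of length at most
    s. Conversely, a vertex at depth exactly s + 1 has its parent in the smaller ball. *)
Lemma iter_parent_ball (T : finType) (r : rel T) (v : T) (par : T -> option T) k :
  (forall u w, par u = Some w -> r w u) -> par v = None ->
  (forall s u, (s < k)%N -> u \in ball r v s.+1 -> u \notin ball r v s ->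
     exists2 w, w \in ball r v s & par u = Some w) ->
  forall s u, (s <= k)%N ->
    (iter s (fun w => odflt w (par w)) u == v) = (u \in ball r v s).
Proof.
move=> par_r par_v par_ball; set up := fun w => _.
elim=> [|s IH] u sk; first by rewrite inE.
rewrite iterSr IH ?(ltnW sk) //; apply/idP/idP => [us|us1].
  move: us; rewrite /up; case E: (par u) => [w|] /= us.
    exact: ball_step us (par_r _ _ E).
  exact: (subsetP (ball_subset _ _ _)).
(* A vertex that reaches [v] early stays there, as [v] has no parent. *)
have [us|us] := boolP (u \in ball r v s).
  have := IH u (ltnW sk); rewrite us => /eqP eu.
  rewrite -IH ?(ltnW sk) // -iterSr iterS eu /up par_v.
  by rewrite eqxx.
by have [w ws pu] := par_ball s u sk us1 us; rewrite /up pu.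
Qed.

(** The successor appears because the dense ball is the larger of the two compared. The cap keeps
    the delay [k - stopping_radius] exact even if no test succeeds, as for eps >= 1, where k = 0. *)
Definition stopping_radius (R : realType) (eps : R) (k : nat) (sizes : seq nat) : nat :=
  minn k (find (fun i => (nth 0%N sizes i.+1)%:R <=
                         (1 + eps / 4) * (nth 0%N sizes i)%:R) (iota 0 k)).+1.

Lemma stopping_radiusP (R : realType) (eps : R) (k : nat) (f : nat -> nat) :
  0 < eps -> (0 < f 0)%N -> (f k)%:R < (1 + eps / 4) ^+ k ->
  exists i, [/\ (i < k)%N, (f i.+1)%:R <= (1 + eps / 4) * (f i)%:R &
    stopping_radius eps k [seq f s | s <- iota 0 k.+1] = i.+1].
Proof.
move=> e0 f0 fk; rewrite /stopping_radius; set stop := (X in find X _).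
have stopE i : (i < k)%N ->
    stop i = ((f i.+1)%:R <= (1 + eps / 4) * (f i)%:R).
  move=> ik; rewrite /stop !(nth_map 0%N) ?size_iota ?ltnS ?(ltnW ik) //.
  by rewrite !nth_iota ?ltnS ?(ltnW ik).
have has_stop : has stop (iota 0 k).
  apply: contraTT fk => /hasPn no_stop; rewrite -leNgt.
  apply: geometric_growth => // [|i ik].
    by rewrite addr_ge0 // divr_ge0 ?ltW.
  have := no_stop i; rewrite mem_iota add0n ik => /(_ isT).
  by rewrite stopE // -ltNge => /ltW.
have ik : (find stop (iota 0 k) < k)%N.
  by rewrite -[X in (_ < X)%N](size_iota 0) -has_find.
exists (find stop (iota 0 k)); split=> //; last by apply/minn_idPr.
by rewrite -stopE //; have := nth_find 0%N has_stop; rewrite nth_iota.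
Qed.

(** * The four phases of the local search *)

Section LocalSearch.
Variables (R : realType) (c : nat) (A : congest R R unit (nat -> R)).

Definition fairness (n : nat) (eps : R) : R := eps ^+ 2 / (128 * log2 R n).

Definition orient_phase : congest R R bool (nat -> R) :=
  reparametrize fairness (fun=> tt) id A.

Definition explore_out (x : bool * (nat -> R)) (j : nat) : bool := 0 < x.2 j.

Definition explore_start (_ : nat) (_ : R) (x : bool * (nat -> R)) : option nat :=
  if x.1 then Some 0%N else None.

Definition explore_phase : congest R R (bool * (nat -> R)) (bool * option nat) :=
  flood R c (@search_radius R) explore_out explore_start.

Definition count_parent (x : bool * (nat -> R) * (bool * option nat)) : option nat :=
  x.2.2.

Definition count_phase :
    congest R R (bool * (nat -> R) * (bool * option nat)) (seq nat) :=
  convergecast R c (@search_radius R) count_parent.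

Definition select_input : Type := bool * (nat -> R) * (bool * option nat) * seq nat.

Definition select_out (x : select_input) : nat -> bool := explore_out x.1.1.

(* Starting the flood late makes it reach exactly the ball of the chosen radius
   without that radius being sent to anybody. *)
Definition select_start (n : nat) (eps : R) (x : select_input) : option nat :=
  let k := search_radius n eps in
  if x.1.1.1 then Some (k - stopping_radius eps k x.2)%N else None.

Definition select_phase : congest R R select_input bool :=
  reparametrize (fun=> id) id fst (flood R c (@search_radius R) select_out select_start).

Definition local_search : congest R R bool bool :=
  seq_compose orient_phase (seq_compose explore_phase
    (seq_compose count_phase select_phase false) false) false.

Variables (N : network R) (eps : R) (v : N).
Hypothesis ident_lt : forall u : N, (ident u < #|N| ^ c)%N.

Let k := search_radius #|N| eps.
Let x0 (u : N) := u == v.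
Let x1 (u : N) := (x0 u, result orient_phase eps x0 u).
Let x2 (u : N) := (x1 u, result explore_phase eps x1 u).
Let x3 (u : N) := (x2 u, result count_phase eps x2 u).
Let share (u w : N) : R := result orient_phase eps x0 u (ident w).
Let reach : nat -> {set N} := ball (positive_share share) v.
Let par (u : N) : option N := obind (neighbour u) (result explore_phase eps x1 u).2.

Let start_x1 (u : N) :
  explore_start #|N| eps (x1 u) = if u == v then Some 0%N else None.
Proof. by []. Qed.

Lemma explore_arc (u : N) j : (result explore_phase eps x1 u).2 = Some j ->
  exists2 w : N, positive_share share w u & ident w = j.
Proof. exact: (flood_parent_arc ident_lt). Qed.

Lemma par_arc (u w : N) : par u = Some w -> positive_share share w u.
Proof.
rewrite /par; case E: (result explore_phase eps x1 u).2 => [j|] // /neighbourP[_ wj].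
have [w' w'u w'j] := explore_arc E.
by have <- : w' = w by apply: ident_inj; rewrite w'j.
Qed.

Lemma ident_par (u : N) : count_parent (x2 u) = omap (@ident R N) (par u).
Proof.
rewrite /par -[count_parent _]/((result explore_phase eps x1 u).2).
case E: (result explore_phase eps x1 u).2 => [j|] //=.
have [w wu <-] := explore_arc E.
by rewrite neighbour_ident // adj_sym; case/andP: wu.
Qed.

Lemma par_ball s (u : N) : (s <= k)%N ->
  (iter s (fun w => odflt w (par w)) u == v) = (u \in reach s).
Proof.
apply: iter_parent_ball; first exact: par_arc.
  rewrite /par; have -> // : (result explore_phase eps x1 v).2 = None.
  exact: (flood_parent_source (@search_radius R) explore_out ident_lt start_x1 erefl).
move=> {}s {}u sk us1 us.
have [w ws pu] := flood_parent_ball (@search_radius R) (out := explore_out)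
  ident_lt start_x1 erefl sk us1 us.
exists w => //; have E : (result explore_phase eps x1 u).2 = Some (ident w) by [].
have [w' w'u /ident_inj w'w] := explore_arc E.
rewrite /par E /= neighbour_ident // adj_sym -w'w.
by case/andP: w'u.
Qed.

(** By [par_ball], the tokens at [v] after s rounds come from exactly the vertices of [reach s]. *)
Lemma count_phase_source :
  result count_phase eps x2 v = [seq #|reach s| | s <- iota 0 k.+1].
Proof.
have par_adj u w : par u = Some w -> adj u w.
  by move=> /par_arc /andP[wu _]; rewrite adj_sym.
apply: etrans (result_convergecast _ _ ident_lt ident_par par_adj _) _.
apply/eq_in_map => s; rewrite mem_iota add0n ltnS => sk.
by apply: eq_card => u; rewrite !inE par_ball.
Qed.

Lemma result_local_search (u : N) : result local_search eps x0 u =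
  (u \in reach (stopping_radius eps k [seq #|reach s| | s <- iota 0 k.+1])).
Proof.
set sizes := [seq _ | s <- _].
rewrite !result_seq_compose result_reparametrize.
have start_x3 w : select_start #|N| eps (x3 w) =
    if w == v then Some (k - stopping_radius eps k sizes)%N else None.
  rewrite /select_start -[(x3 w).1.1.1]/(w == v); case: eqP => // ->.
  by rewrite -[(x3 v).2]/(result count_phase eps x2 v) count_phase_source.
(* A delay of k - r out of k rounds leaves exactly r rounds of flooding, since r <= k. *)
apply: etrans (result_flood select_out ident_lt start_x3 _ _) _; first exact: leq_subr.
by rewrite subKn // geq_minl.
Qed.

End LocalSearch.

Theorem theorem44 (R : realType) (c : nat) (W : nat -> R -> Prop)
    (U : nat -> R -> R) :
  (exists A : congest R R unit (nat -> R),
     round_bigO (rounds A) U /\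
     forall (N : network R) (eta : R), admissible c W N -> 0 < eta ->
       let g := fun u v : N => result A eta (fun _ => tt) u (ident v) in
       fractional_orientation g /\ fair eta g) ->
  exists B : congest R R bool bool,
    round_bigO (rounds B) (fun n eps =>
      U n (eps ^+ 2 / (128 * log2 R n)) + log2 R n ^+ 3 / eps ^+ 3) /\
    forall (N : network R) (eps : R) (v : N), admissible c W N -> 0 < eps ->
      let H := [set u : N | result B eps (fun u => u == v) u] in
      v \in H /\ (1 - eps) * rho_star v <= density H.
Proof.
case=> A [[C C0 roundsA] correctA]; exists (local_search c A); split.
  (* [C] pays for the orientation; exploring, counting and selecting take k rounds each, and k is at
     most 10 times the second term. *)
  exists (C + 30) => [|n eps n1 e0]; first by rewrite addr_gt0.
  have L0 : 0 < log2 R n by apply: lt_le_trans (le1_log2 R n1).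
  have eta0 : 0 < fairness n eps by rewrite divr_gt0 ?exprn_gt0 // mulr_gt0.
  have rA := roundsA n _ n1 eta0; have rk := search_radius_bigO n1 e0.
  (* This value of [U] is nonnegative because [C] times it bounds a number of rounds. *)
  have U0 : 0 <= U n (fairness n eps).
    by rewrite -(pmulr_rge0 _ C0) (le_trans _ rA).
  have Q0 : 0 <= log2 R n ^+ 3 / eps ^+ 3 by rewrite divr_ge0 // exprn_ge0 // ltW.
  rewrite /= !natrD -/(fairness n eps).
  move: rA rk U0 Q0; move: (rounds A _ _)%:R (U _ _) (search_radius _ _)%:R (_ / _).
  by move=> a b k q; nra.
move=> N eps v adm e0 H; have [ident_lt _] := adm.
pose share (u w : N) := result (orient_phase A) eps (fun u => u == v) u (ident w).
pose reach := ball (positive_share share) v.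
pose k := search_radius #|N| eps.
pose i := stopping_radius eps k [seq #|reach s| | s <- iota 0 k.+1].
have -> : H = reach i by apply/setP => u; rewrite inE result_local_search.
split; first exact: mem_ball.
have density0 : 0 <= density (reach i) by rewrite divr_ge0 ?inner_weight_ge0.
have r0 := rho_star_ge0 v.
have [e1|e1] := leP 1 eps.
  by apply: le_trans density0; rewrite mulr_le0_ge0 // subr_le0.
(* A single vertex has no edges. It is treated apart because log 1 = 0 makes [fairness] equal to 0,
   where nothing is known about [A]. *)
have [n1|n1] := leqP #|N| 1.
  suff -> : rho_star v = 0 by rewrite mulr0.
  rewrite /rho_star /local_density big1 ?mul0r // => e.
  rewrite inE => /andP[/card_edge e2].
  by have := max_card (mem e); rewrite e2 leqNgt ltnS n1.
have e01 : 0 < eps < 1 by rewrite e0.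
have L0 : 0 < log2 R #|N| by apply: lt_le_trans (le1_log2 R n1).
have eta0 : 0 < fairness #|N| eps by rewrite divr_gt0 ?exprn_gt0 // mulr_gt0.
have gE (u w : N) :
    share u w = result A (fairness #|N| eps) (fun=> tt) u (ident w).
  by rewrite /share result_reparametrize.
have [frac fairA] : fractional_orientation share /\ fair (fairness #|N| eps) share.
  have [frac fairA] := correctA N _ adm eta0.
  have -> : share = fun u w => result A (fairness #|N| eps) (fun=> tt) u (ident w).
    by apply: funext => u; apply: funext => w; apply: gE.
  by [].
have nk := search_radius_growth #|N| e01.
have [|| j [jk small iE]] := @stopping_radiusP _ eps k (fun s => #|reach s|) e0.
- by rewrite card_gt0; apply/set0Pn; exists v; apply: mem_ball.
- by apply: le_lt_trans nk; rewrite ler_nat max_card.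
rewrite /i iE in density0 *.
have d0 : 0 <= eps / 4 by rewrite divr_ge0 ?ltW.
have bound := ball_density frac (ltW eta0) fairA d0 nk jk small.
apply: le_trans (ler_wpM2l _ bound) _; first by rewrite subr_ge0 ltW.
rewrite mulrA -[leRHS]mul1r ler_wpM2r //.
exact: fairness_power.
Qed.
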